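(* For all integers $m,n\ge1$, the Möbius coinvariant of the complete bipartite graph $K_{m,n}$ is $\mu^\perp(K_{m,n})=(m-1)(n-1)\,H_{m-2,\,n-2}(n-1,m-1)$.
   Context: For a directed graph $G$ on $[d]$ with edge multiset $E$, $v_e=\mathbf{e}_i-\mathbf{e}_j$ for $e=(i\to j)$; $V_G=\{\lambda:E\to\mathbb{R}:\sum_e\lambda(e)v_e=0\}$; the cographic arrangement consists of $H_e=\{\lambda\in V_G:\lambda(e)=0\}$ (orientation irrelevant). $\mu^\perp(G)=|\mu_{L^\perp_G}(\hat0,\hat1)|$ for its intersection lattice ordered by reverse inclusion; equivalently $\mu^\perp(G)=T_G(0,1)$ with $T_G$ the Tutte polynomial (so $\mu^\perp(G)=0$ if $G$ has an isthmus). Bipartite Hermite polynomials: $H_{a,b}(x,y)=\sum_M x^{\alpha(M)}y^{\beta(M)}$ over all partial matchings $M$ of $K_{a,b}$, where $\alpha(M)$ (resp. $\beta(M)$) is the number of vertices of the first (resp. second) part not covered by $M$; $H_{a,0}=x^a$, $H_{0,b}=y^b$, and $H_{a,b}=0$ if $a<0$ or $b<0$. *)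

(* Defs.v *)
From HB Require Import structures.
From mathcomp Require Import all_boot all_order all_algebra.
From mathcomp Require Import reals.

Set Implicit Arguments.
Unset Strict Implicit.
Unset Printing Implicit Defensive.

Import Order.TTheory GRing.Theory Num.Theory.
Local Open Scope ring_scope.

Section Mobius.
Variables (disp : Order.disp_t) (P : finPOrderType disp).

(* k is fuel: the recursive calls strictly decrease y, so #|P| steps suffice;
   see mobiusE. *)
Fixpoint mobius_fuel (k : nat) (x y : P) : int :=
  if k is k'.+1 then
    if x == y then 1
    else if (x < y)%O then
      - \sum_(z : P | (x <= z)%O && (z < y)%O) mobius_fuel k' x z
    else 0
  else 0.

Definition mobius (x y : P) : int := mobius_fuel #|P| x y.

Lemma mobius_fuel_enough (k : nat) (x y : P) :
  (#|[set z : P | (z <= y)%O]| <= k)%N ->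
  mobius_fuel k x y = mobius_fuel #|P| x y.
Proof.
have main k1 k2 u v : (#|[set z : P | (z <= v)%O]| <= k1)%N ->
    (#|[set z : P | (z <= v)%O]| <= k2)%N ->
    mobius_fuel k1 u v = mobius_fuel k2 u v.
  have pos w : (0 < #|[set z : P | (z <= w)%O]|)%N.
    by apply/card_gt0P; exists w; rewrite inE.
  elim: k1 k2 u v => [|k1 IH] [|k2] u v le1 le2 //=.
  - by have := leq_trans (pos v) le1.
  - by have := leq_trans (pos v) le2.
  case: eqP => // _; case: ifP => // _; congr (- _).
  apply: eq_bigr => z /andP[_ ltzv].
  have lt_card : (#|[set w : P | (w <= z)%O]| < #|[set w : P | (w <= v)%O]|)%N.
    apply: proper_card; apply/properP; split.
      by apply/subsetP => w; rewrite !inE => /le_trans; apply; apply: ltW.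
    by exists v; rewrite !inE ?lexx // lt_geF.
  by apply: IH; rewrite -ltnS; apply: leq_trans lt_card _.
by move=> le_k; apply: main => //; apply: max_card.
Qed.

Lemma mobiusE (x y : P) : mobius x y =
  if x == y then 1
  else if (x < y)%O then - \sum_(z : P | (x <= z)%O && (z < y)%O) mobius x z
  else 0.
Proof.
rewrite {1}/mobius -(mobius_fuel_enough (k := #|P|.+1)) /=; last first.
  exact: leqW (max_card _).
by [].
Qed.

End Mobius.

Fact arrangement_display : Order.disp_t. Proof. exact: Order.Disp tt tt. Qed.

Section IntersectionLattice.
Variables (F : fieldType) (vT : vectType F) (E : finType).
Variables (V : {vspace vT}) (H : E -> {vspace vT}).

Definition arr_flat (S : {set E}) : {vspace vT} :=
  (V :&: \bigcap_(e in S) H e)%VS.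

Definition intersection_lattice : Type :=
  seq_sub [seq arr_flat A | A : {set E}].

HB.instance Definition _ := Finite.on intersection_lattice.
HB.instance Definition _ := SubType.on intersection_lattice.

Implicit Types U W : intersection_lattice.

(* reverse inclusion *)
Definition arr_le U W : bool := (val W <= val U)%VS.

Fact arr_le_refl : reflexive arr_le.
Proof. by move=> U; apply: subvv. Qed.

Fact arr_le_anti : antisymmetric arr_le.
Proof. by move=> U W le_UW; apply/val_inj/eqP; rewrite eqEsubv andbC. Qed.

Fact arr_le_trans : transitive arr_le.
Proof. by move=> U W X le_WU le_UX; apply: subv_trans le_UX le_WU. Qed.

HB.instance Definition _ :=
  Order.Le_isPOrder.Build arrangement_display intersection_lattice
    arr_le_refl arr_le_anti arr_le_trans.

Definition flat_elt (S : {set E}) : intersection_lattice :=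
  SeqSub (image_f arr_flat (isT : S \in {: {set E}})).

Fact arr_bot_le U : (flat_elt set0 <= U)%O.
Proof.
change (val U <= arr_flat set0)%VS.
by have /imageP[A _ ->] := valP U; rewrite /arr_flat big_set0 capvf capvSl.
Qed.

Fact arr_le_top U : (U <= flat_elt setT)%O.
Proof.
change (arr_flat setT <= val U)%VS.
have /imageP[A _ ->] := valP U; apply: capvS => //.
by apply/subv_bigcapP => e _; apply: bigcapv_inf (subvv _); rewrite inE.
Qed.

HB.instance Definition _ := Order.hasBottom.Build
  arrangement_display intersection_lattice arr_bot_le.
HB.instance Definition _ := Order.hasTop.Build
  arrangement_display intersection_lattice arr_le_top.

End IntersectionLattice.

Record digraph (d : nat) := Digraph {
  edge : finType;
  src : edge -> 'I_d;
  tgt : edge -> 'I_d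
}.

Section Cographic.
Variables (R : realType) (d : nat) (G : digraph d).

Definition edge_vec (e : edge G) : 'rV[R]_d :=
  delta_mx 0 (src e) - delta_mx 0 (tgt e).

Definition boundary (l : {ffun edge G -> R^o}) : 'rV[R]_d :=
  \sum_e l e *: edge_vec e.

Fact boundary_is_linear : linear boundary.
Proof.
move=> a u v; rewrite /boundary scaler_sumr -big_split /=.
by apply: eq_bigr => e _; rewrite !ffunE scalerDl scalerA.
Qed.
HB.instance Definition _ :=
  GRing.isLinear.Build R {ffun edge G -> R^o} 'rV[R]_d _ boundary
    boundary_is_linear.

Definition flow_space : {vspace {ffun edge G -> R^o}} := lker (linfun boundary).

Definition edge_coord (e : edge G) (l : {ffun edge G -> R^o}) : R^o := l e.

Fact edge_coord_is_linear e : linear (edge_coord e).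
Proof. by move=> a u v; rewrite /edge_coord !ffunE. Qed.
HB.instance Definition _ e :=
  GRing.isLinear.Build R {ffun edge G -> R^o} R^o _ (edge_coord e)
    (edge_coord_is_linear e).

Definition cographic_hyperplane (e : edge G) : {vspace {ffun edge G -> R^o}} :=
  (flow_space :&: lker (linfun (edge_coord e)))%VS.

Lemma mem_flow_space l :
  (l \in flow_space) = (\sum_e l e *: edge_vec e == 0).
Proof. by rewrite memv_ker lfunE. Qed.

Lemma mem_cographic_hyperplane e l :
  (l \in cographic_hyperplane e) = (l \in flow_space) && (l e == 0).
Proof. by rewrite memv_cap; congr (_ && _); rewrite memv_ker lfunE. Qed.

Definition cographic_lattice : Type :=
  intersection_lattice flow_space cographic_hyperplane.

HB.instance Definition _ := SubType.on cographic_lattice.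
HB.instance Definition _ := Order.FinTBPOrder.on cographic_lattice.

Lemma val_cographic_bot : val (\bot%O : cographic_lattice) = flow_space.
Proof.
change (arr_flat flow_space cographic_hyperplane set0 = flow_space).
by rewrite /arr_flat big_set0 capvf.
Qed.

Lemma val_cographic_top : val (\top%O : cographic_lattice) = 0%VS.
Proof.
change (arr_flat flow_space cographic_hyperplane setT = 0%VS).
apply/eqP; rewrite -subv0; apply/subvP => l /memv_capP[_ /subvP].
move=> sub_l; rewrite memv0; apply/eqP/ffunP => e; rewrite ffunE.
have /subv_bigcapP/(_ e (in_setT e)) := introT subvP sub_l.
by rewrite -memvE mem_cographic_hyperplane => /andP[_ /eqP].
Qed.

End Cographic.

Section Isthmus.
Variables (d : nat) (G : digraph d).

Definition adj_without (e : edge G) : rel 'I_d := fun u v =>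
  [exists f : edge G, (f != e) &&
     (((src f == u) && (tgt f == v)) || ((src f == v) && (tgt f == u)))].

Definition isthmus (e : edge G) : bool :=
  ~~ connect (adj_without e) (src e) (tgt e).

End Isthmus.

(* An isthmus e is a loop of the cographic matroid: H_e is then all of V_G, not
   a hyperplane, and the value is 0 = T_G(0,1) by convention. The bare lattice
   would forget such an e; e.g. for a tree it is a single point, with Mobius
   number 1. *)
Definition mobius_coinvariant (R : realType) (d : nat) (G : digraph d) : int :=
  if [exists e : edge G, isthmus e] then 0
  else `|mobius (\bot%O : cographic_lattice R G) (\top%O : cographic_lattice R G)|.

Definition complete_bipartite (m n : nat) : digraph (m + n) :=
  @Digraph (m + n) ('I_m * 'I_n)%type
    (fun p => lshift n p.1) (fun p => rshift m p.2).

Section Hermite.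
Variables a b : nat.

Definition is_matching (M : {set 'I_a * 'I_b}) : bool :=
  [forall p in M, forall q in M,
     (p != q) ==> (p.1 != q.1) && (p.2 != q.2)].

Definition uncovered1 (M : {set 'I_a * 'I_b}) : nat :=
  #|[set i : 'I_a | [forall p in M, p.1 != i]]|.

Definition uncovered2 (M : {set 'I_a * 'I_b}) : nat :=
  #|[set j : 'I_b | [forall p in M, p.2 != j]]|.

(* With the conventions of polyXY, x is the outer variable 'X and y the inner
   one 'Y, so that p.[x, y] substitutes x and y in this order. *)
Definition bip_hermite_nat : {poly {poly int}} :=
  \sum_(M : {set 'I_a * 'I_b} | is_matching M)
     'X^(uncovered1 M) * 'Y ^+ (uncovered2 M).

End Hermite.

Definition bip_hermite (a b : int) : {poly {poly int}} :=
  match a, b with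
  | Posz a', Posz b' => bip_hermite_nat a' b'
  | _, _ => 0
  end.

Lemma bip_hermite_horner (a b : nat) (x y : int) :
  (bip_hermite a b).[x, y] =
  \sum_(M : {set 'I_a * 'I_b} | is_matching M)
     x ^+ uncovered1 M * y ^+ uncovered2 M.
Proof.
rewrite /= /bip_hermite_nat !horner_sum; apply: eq_bigr => M _.
by rewrite hornerM !hornerXn -polyC_exp hornerC hornerM -!polyC_exp hornerC hornerXn.
Qed.

(* Main.v *)
Require Import Defs.
From mathcomp Require Import all_boot all_order all_algebra.
From mathcomp Require Import reals.
From mathcomp Require Import perm ring zify.
Import Order.TTheory GRing.Theory Num.Theory.
Local Open Scope ring_scope.

Set Implicit Arguments.
Unset Strict Implicit.
Unset Printing Implicit Defensive.

(**
The crosscut theorem turns the Möbius number of the cographic arrangement of a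
graph without isthmus into the signed sum of [(-1)^|F|] over the forests [F].
In a forest every tree [T] satisfies [|V(T)| - |E(T)| = 1], so each tree may be
rooted at a vertex, or, with the opposite sign, at an edge. The root edges form
a matching [M], and the matrix-tree theorem sums the remaining choices:
  [sum_F (-1)^|F| = sum_M det (1 - L)_(V \ V(M))]
with [L] the Laplacian. We prove this identity by deletion and contraction of
an edge. For [K_(m,n)] the determinant is a rank-two perturbation of a diagonal
matrix; with [x = n-1] and [y = m-1] and up to sign, the sum becomes
[m n H_(m-1,n-1)(x,y) - H_(m,n)(x,y)], which the recurrences of the bipartite
Hermite polynomials reduce to [x y H_(m-2,n-2)(x,y)].
*)

(** * Determinants with frozen rows *)

Lemma det_block_mx1 (K : comNzRingType) (p q : nat) (X : 'M[K]_(p, q)) (Y : 'M_(q, p)) :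
  \det (block_mx 1%:M X Y 1%:M) = \det (1%:M - Y *m X).
Proof.
have -> : block_mx 1%:M X Y 1%:M =
          block_mx 1%:M 0 Y 1%:M *m block_mx 1%:M X 0 (1%:M - Y *m X).
  by rewrite mulmx_block !mul1mx !mulmx1 ?mul0mx ?mulmx0 ?addr0 addrC subrK.
by rewrite det_mulmx det_lblock det_ublock !det1 !mul1r.
Qed.

(** Sylvester's identity: the same block matrix with unit diagonal blocks is eliminated in two
    ways. *)
Lemma det_1DmulC (K : comNzRingType) (p q : nat) (X : 'M[K]_(p, q)) (Y : 'M_(q, p)) :
  \det (1%:M + X *m Y) = \det (1%:M + Y *m X).
Proof.
have -> : 1%:M + Y *m X = 1%:M - Y *m - X by rewrite mulmxN opprK.
rewrite -det_block_mx1.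
have -> : block_mx 1%:M (- X) Y 1%:M =
          block_mx (1%:M + X *m Y) (- X) 0 1%:M *m block_mx 1%:M 0 Y 1%:M.
  by rewrite mulmx_block !mul1mx !mulmx1 mul0mx mulmx0 !add0r mulNmx addrK.
by rewrite det_mulmx det_lblock det_ublock !det1 !mulr1.
Qed.

Section FrozenMinors.
Variables (K : comNzRingType) (d : nat).
Implicit Types (A B : 'M[K]_d) (W : {set 'I_d}) (u v : 'I_d).

(* The determinant of [freeze W A] is the principal minor of [A] off [W]; this
   avoids matrices indexed by subsets. *)
Definition freeze W A : 'M[K]_d :=
  \matrix_(i, j) if i \in W then (i == j)%:R else A i j.

Definition pminor W A : K := \det (freeze W A).

Lemma freeze0 A : freeze set0 A = A.
Proof. by apply/matrixP => i j; rewrite !mxE inE. Qed.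

Lemma freezeU W W' A : freeze W (freeze W' A) = freeze (W :|: W') A.
Proof. by apply/matrixP => i j; rewrite !mxE inE; case: (i \in W). Qed.

Lemma eq_pminor W A B :
  (forall i j, i \notin W -> j \notin W -> A i j = B i j) ->
  pminor W A = pminor W B.
Proof.
move=> eqAB; apply: eq_bigr => s _; congr (_ * _).
case: (boolP [exists i in W, s i != i]) => [/exists_inP[i iW si]|].
  have z C : \prod_j freeze W C j (s j) = 0.
    by rewrite (bigD1 i) //= mxE iW eq_sym (negPf si) mul0r.
  by rewrite !z.
rewrite negb_exists_in => /forall_inP fixW; apply: eq_bigr => i _.
rewrite !mxE; case: ifPn => // iW; apply: eqAB => //.
apply: contra iW => siW; have := fixW _ siW.
by rewrite negbK (inj_eq perm_inj) => /eqP sii; rewrite -sii.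
Qed.

(** Multilinearity in row [v], which is the sum of the row of [A - delta_mx v v] and a unit row. *)
Lemma pminor_subdelta W A v : v \notin W ->
  pminor W A - pminor W (A - delta_mx v v) = pminor (v |: W) A.
Proof.
move=> vW; apply/eqP; rewrite subr_eq; apply/eqP.
rewrite -[RHS]addrC -[pminor W (A - _)]mul1r -[pminor (v |: W) A]mul1r.
apply: (@determinant_multilinear _ _ _ _ _ v).
- by apply/rowP => j; rewrite !mxE (negPf vW) setU11 !eqxx !mul1r eq_sym subrK.
- apply/matrixP => i j; rewrite !mxE; case: ifP => // _.
  by rewrite eq_sym (negPf (neq_lift _ _)) subr0.
- apply/matrixP => i j; rewrite !mxE in_setU1.
  by rewrite eq_sym (negPf (neq_lift _ _)).
Qed.

End FrozenMinors.

(** * Deletion and contraction of matching sums *)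

Section DeletionContraction.
Variables (K : comNzRingType) (d : nat).
Implicit Types (A B : 'M[K]_d) (W : {set 'I_d}) (e f : 'I_d * 'I_d).
Implicit Types s : seq ('I_d * 'I_d).

(* The sum of [pminor (W :|: V(M)) A] over the matchings [M] of the edge list
   [s] that avoid [W]. *)
Fixpoint matching_sum s A W : K :=
  if s is e :: s' then
    matching_sum s' A W +
    (if [&& e.1 != e.2, e.1 \notin W & e.2 \notin W]
     then matching_sum s' A (e.1 |: (e.2 |: W)) else 0)
  else pminor W A.

Definition incidence e : 'rV[K]_d := delta_mx 0 e.1 - delta_mx 0 e.2.

Definition laplacian s : 'M[K]_d :=
  \sum_(e <- s) (incidence e)^T *m incidence e.

(* Contraction of [e] keeps the vertex set: [e.2] becomes an isolated vertex,
   which changes neither side of the forest identity. *)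
Definition merge_vertex e (i : 'I_d) : 'I_d := if i == e.2 then e.1 else i.
Definition merge_edge e f := (merge_vertex e f.1, merge_vertex e f.2).

Definition merge_mx e : 'M[K]_d := 1%:M + delta_mx e.2 e.1 - delta_mx e.2 e.2.

(** For [A = 1 - L] the conjugated matrix [A - 1] is [- L], a sum over edges in which merging sends
    each term to that of the merged edge. Adding the identity back gives the isolated vertex [e.2] a
    unit row. *)
Definition contract e A : 'M[K]_d :=
  1%:M + (merge_mx e)^T *m (A - 1%:M) *m merge_mx e.

Lemma merge_mxE e i j : merge_mx e i j = (merge_vertex e i == j)%:R.
Proof.
rewrite !mxE /merge_vertex; case: (eqVneq i e.2) => [->|] /=; last by rewrite subr0 addr0.
by rewrite [e.2 == j]eq_sym addrAC subrr add0r [j == _]eq_sym.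
Qed.

Lemma incidence_merge e f :
  incidence (merge_edge e f) = incidence f *m merge_mx e.
Proof.
have r i : delta_mx 0 (merge_vertex e i) = delta_mx 0 i *m merge_mx e :> 'rV[K]_d.
  by apply/rowP => j; rewrite -rowE [RHS]mxE merge_mxE mxE eqxx eq_sym.
by rewrite mulmxBl -!r.
Qed.

Lemma contract_laplacian e s :
  contract e (1%:M - laplacian s) = 1%:M - laplacian (map (merge_edge e) s).
Proof.
rewrite /contract addrAC subrr add0r mulmxN mulNmx; congr (_ - _).
rewrite /laplacian big_map mulmx_sumr mulmx_suml; apply: eq_bigr => f _.
by rewrite incidence_merge trmx_mul !mulmxA.
Qed.

(** For a non-loop [e] this column operation has determinant 1 and sends [incidence e] to
    [- delta_mx 0 e.2], so conjugation turns the rank-one term of [e] into one diagonal unit. *)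
Definition shear_mx e : 'M[K]_d := 1%:M + delta_mx e.2 e.1.

Lemma shear_conjE e A i j : ((shear_mx e)^T *m A *m shear_mx e) i j =
  A i j + (j == e.1)%:R * A i e.2 +
  (i == e.1)%:R * (A e.2 j + (j == e.1)%:R * A e.2 e.2).
Proof.
have mulr B k l : (B *m shear_mx e) k l = B k l + (l == e.1)%:R * B k e.2.
  rewrite mulmxDr mulmx1 mxE; congr (_ + _).
  rewrite mxE (bigD1 e.2) //= big1 ?addr0 => [|h /negPf hv]; rewrite mxE ?hv ?mulr0 //.
  by rewrite eqxx mulrC.
have mull B k l : ((shear_mx e)^T *m B) k l = B k l + (k == e.1)%:R * B e.2 l.
  have -> : ((shear_mx e)^T *m B) k l = (B^T *m shear_mx e) l k.
    by rewrite -[in RHS](trmxK (shear_mx e)) -trmx_mul [RHS]mxE.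
  by rewrite mulr !mxE.
by rewrite mulr !mull; ring.
Qed.

(** Merging and shearing differ only in column [e.2]. The correction at [e.1] arises because in
    [A - 1] the identity is conjugated too and gains a second unit there. *)
Lemma contractE e A i j : e.1 != e.2 -> i != e.2 -> j != e.2 ->
  contract e A i j =
  ((shear_mx e)^T *m A *m shear_mx e - delta_mx e.1 e.1) i j.
Proof.
move=> uv iv jv.
rewrite /contract [LHS]mxE [RHS]mxE.
have -> : ((merge_mx e)^T *m (A - 1%:M) *m merge_mx e) i j =
          ((shear_mx e)^T *m (A - 1%:M) *m shear_mx e) i j.
  have eq_mx k l : l != e.2 -> merge_mx e k l = shear_mx e k l.
    by move=> /negPf lv; rewrite !mxE lv andbF subr0.
  rewrite [LHS]mxE [RHS]mxE; apply: eq_bigr => k _; rewrite eq_mx //.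
  congr (_ * _); rewrite [LHS]mxE [RHS]mxE; apply: eq_bigr => l _.
  by congr (_ * _); rewrite [LHS]mxE [RHS]mxE eq_mx.
rewrite !shear_conjE !mxE [e.2 == j]eq_sym (negPf iv) (negPf jv) eqxx.
by case: (i == e.1); case: (j == e.1); rewrite /=; ring.
Qed.

Lemma contract_row e A j : e.1 != e.2 -> contract e A e.2 j = (e.2 == j)%:R.
Proof.
move=> uv; rewrite [LHS]mxE [X in X + _]mxE -mulmxA [X in _ + X]mxE.
rewrite big1 ?addr0 // => k _; rewrite [X in X * _]mxE merge_mxE /merge_vertex.
by case: (eqVneq k e.2) => [_|/negPf kv]; rewrite ?(negPf uv) ?kv mul0r.
Qed.

Lemma det_shear e : e.1 != e.2 -> \det (shear_mx e) = 1.
Proof.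
move=> uv; rewrite /shear_mx -(mul_delta_mx (0 : 'I_1)) det_1DmulC.
by rewrite mul_delta_mx_0 // addr0 det1.
Qed.

Lemma incidence_shear e : e.1 != e.2 ->
  incidence e *m shear_mx e = - delta_mx 0 e.2.
Proof.
move=> uv; rewrite mulmxBl !mulmxDr !mulmx1 mul_delta_mx mul_delta_mx_0 //.
by rewrite addr0 opprD addrCA subrr addr0.
Qed.

(** After the shear, removing the edge term subtracts the diagonal unit at [e.2], so the first
    difference is the minor of the sheared matrix [C] off [e.2]. Taking away the minor off both ends
    subtracts the unit at [e.1] in the same way, and [contractE] recognizes the contraction. *)
Lemma pminor_contract e A W : e.1 != e.2 -> e.1 \notin W -> e.2 \notin W ->
  pminor W A - pminor W (A - (incidence e)^T *m incidence e)
    - pminor (e.1 |: (e.2 |: W)) A = pminor W (contract e A).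
Proof.
move=> uv uW vW.
pose B := freeze W A; pose C := (shear_mx e)^T *m B *m shear_mx e.
(* Both ends of [e] lie off [W], so the edge term has zero rows in [W]. *)
have frz : freeze W (A - (incidence e)^T *m incidence e)
           = B - (incidence e)^T *m incidence e.
  apply/matrixP => i j; rewrite !mxE; case: ifP => // iW.
  rewrite big1 ?subr0 // => k _; rewrite !mxE.
  suff [-> ->] : (i == e.1) = false /\ (i == e.2) = false by rewrite andbF subrr mul0r.
  by split; apply: contraTF iW => /eqP ->.
have conj_det X : \det ((shear_mx e)^T *m X *m shear_mx e) = \det X.
  by rewrite !det_mulmx det_tr det_shear // mul1r mulr1.
have -> : pminor W A = pminor set0 C by rewrite /pminor freeze0 conj_det.
have -> : pminor W (A - (incidence e)^T *m incidence e)
          = pminor set0 (C - delta_mx e.2 e.2).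
  rewrite /pminor freeze0 frz -conj_det mulmxBr mulmxBl; congr (\det (_ - _)).
  rewrite mulmxA -trmx_mul -mulmxA incidence_shear // [(- _)^T]raddfN mulNmx mulmxN.
  by rewrite opprK /= trmx_delta mul_delta_mx.
rewrite pminor_subdelta ?inE // setU0.
have u2 : e.1 \notin [set e.2] by rewrite inE.
have -> : pminor (e.1 |: (e.2 |: W)) A = pminor (e.1 |: [set e.2]) C.
  rewrite /pminor setUA -freezeU -/B; apply: eq_pminor => i j.
  rewrite !inE !negb_or => /andP[iu iv] /andP[ju jv].
  by rewrite shear_conjE (negPf iu) (negPf ju) !mul0r !addr0.
rewrite -pminor_subdelta // opprB addrC subrK.
(* Row [e.2] of a contraction is a unit row already, so it may be frozen and the comparison made off
   [e.2] only. *)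
have -> : pminor W (contract e A) = pminor [set e.2] (freeze W (contract e A)).
  rewrite /pminor; congr (\det _); apply/matrixP => i j; rewrite [RHS]mxE inE.
  by case: eqP => // ->; rewrite mxE (negPf vW) contract_row.
apply: eq_pminor => i j; rewrite !inE => iv jv.
rewrite [RHS]mxE; case: ifPn => iW; last first.
  rewrite contractE // [LHS]mxE [RHS]mxE !shear_conjE !mxE (negPf iW) (negPf vW).
  by [].
have iu : (i == e.1) = false by apply: contraTF iW => /eqP ->.
by rewrite [LHS]mxE shear_conjE !mxE iW iu (negPf iv) !mul0r mulr0 subr0 !addr0.
Qed.

Lemma eq_matching_sum s A B W :
  (forall i j, i \notin W -> j \notin W -> A i j = B i j) ->
  matching_sum s A W = matching_sum s B W.
Proof.
elim: s W => [|f s IH] W eqAB /=; first exact: eq_pminor.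
congr (_ + _); first exact: IH.
case: ifP => // _; apply: IH => i j.
by rewrite !inE !negb_or => /and3P[_ _ iW] /and3P[_ _ jW]; apply: eqAB.
Qed.

(** Matchings that cover [v] freeze its row and do not see the change, so they cancel; on the others
    [pminor_subdelta] applies. *)
Lemma matching_sum_subdelta s A W (v : 'I_d) : v \notin W ->
  matching_sum s A W - matching_sum s (A - delta_mx v v) W
    = matching_sum s A (v |: W).
Proof.
elim: s W => [|f s IH] W vW /=; first exact: pminor_subdelta.
rewrite opprD addrACA IH //; congr (_ + _).
case: (boolP [&& _, _ & _]) => [/and3P[xy xW yW]|]; last first.
  rewrite subrr; case: ifP => // /and3P[xy]; rewrite !inE !negb_or.
  by move=> /andP[_ ->] /andP[_ ->]; rewrite xy.
rewrite xy !in_setU1 (negPf xW) (negPf yW) !orbF.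
have [->|xv] := eqVneq f.1 v; [|have [->|yv] := eqVneq f.2 v].
- rewrite andbF; apply/eqP; rewrite subr_eq0; apply/eqP/eq_matching_sum => i j.
  by rewrite !inE !negb_or => /and3P[/negPf iv _ _] _; rewrite !mxE iv subr0.
- rewrite !andbF; apply/eqP; rewrite subr_eq0; apply/eqP/eq_matching_sum => i j.
  by rewrite !inE !negb_or => /and3P[_ /negPf iv _] _; rewrite !mxE iv subr0.
rewrite IH; last by rewrite !inE ![v == _]eq_sym (negPf xv) (negPf yv) (negPf vW).
by congr matching_sum; rewrite setUCA; congr setU; rewrite setUCA.
Qed.

(** Since [e.1] is frozen, no edge at the merged vertex can be used; before merging this excludes
    edges at either end of [e], whence [e.2] on the right. *)
Lemma matching_sum_merge_covered e s A W : e.1 != e.2 -> e.1 \in W ->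
  matching_sum (map (merge_edge e) s) (contract e A) W
    = matching_sum s A (e.2 |: W).
Proof.
move=> uv; elim: s W => [|f s IH] W uW /=.
  have -> : pminor W (contract e A) = pminor (e.2 |: W) (contract e A).
    rewrite /pminor; congr (\det _); apply/matrixP => i j; rewrite [LHS]mxE [RHS]mxE.
    by rewrite in_setU1; case: (eqVneq i e.2) => [->|] //=; rewrite contract_row ?if_same.
  apply: eq_pminor => i j; rewrite !in_setU1 !negb_or => /andP[iv iW] /andP[jv jW].
  have iu : (i == e.1) = false by apply: contraNF iW => /eqP ->.
  have ju : (j == e.1) = false by apply: contraNF jW => /eqP ->.
  by rewrite contractE // [LHS]mxE shear_conjE !mxE iu ju !mul0r !addr0 subr0.
congr (_ + _); first exact: IH.
have mergeW x : (merge_vertex e x \notin W) = (x \notin e.2 |: W).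
  by rewrite /merge_vertex in_setU1; case: (eqVneq x e.2) => //; rewrite uW.
rewrite !mergeW.
case: (boolP (f.1 \in _)) => [|xW]; first by rewrite !andbF.
case: (boolP (f.2 \in _)) => [|yW]; first by rewrite !andbF.
have id_merge x : x \notin e.2 |: W -> merge_vertex e x = x.
  by rewrite in_setU1 negb_or /merge_vertex => /andP[/negPf ->].
rewrite !id_merge // IH; last by rewrite !inE uW !orbT.
by case: ifP => // _; congr matching_sum; rewrite setUCA; congr setU; rewrite setUCA.
Qed.

(** With one end [w'] frozen, the edge term acts as the diagonal unit at the free end [w], which
    [matching_sum_subdelta] trades for freezing [w]. *)
Lemma matching_sum_half e s A W : e.1 != e.2 ->
  (e.1 \in W) != (e.2 \in W) ->
  matching_sum s A W - matching_sum s (A - (incidence e)^T *m incidence e) W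
    = matching_sum s A (e.1 |: (e.2 |: W)).
Proof.
move=> uv half.
have [w [w' [wW wW' E]]] : exists w w', [/\ w \notin W, w' \in W &
    (w = e.1 /\ w' = e.2) \/ (w = e.2 /\ w' = e.1)].
  move: half; case: (boolP (e.1 \in W)) => uW; case: (boolP (e.2 \in W)) => vW // _.
    by exists e.2, e.1; split=> //; right.
  by exists e.1, e.2; split=> //; left.
have -> : matching_sum s (A - (incidence e)^T *m incidence e) W =
          matching_sum s (A - delta_mx w w) W.
  apply: eq_matching_sum => i j iW jW; rewrite !mxE; congr (_ - _).
  rewrite big_ord1 !mxE !eqxx /=.
  have ne k : k \notin W -> (k == w') = false by apply: contraNF => /eqP->.
  by case: E => -[<- <-]; rewrite !ne // ?subr0 ?sub0r ?mulrNN -natrM mulnb.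
rewrite matching_sum_subdelta //; congr matching_sum.
have W' : w' |: W = W by apply/setUidPr; rewrite sub1set.
by case: E => -[<- <-]; rewrite ?W' // setUCA W'.
Qed.

(** Induction on the edge list, from [pminor_contract]. Matchings through a new edge [f] are
    compared by the number of ends that [f] shares with [e]. If both lie on [e], then [f] becomes a
    loop and nothing remains on either side; if one does, the two preceding lemmas apply; if none
    does, the induction hypothesis applies with the ends of [f] frozen. *)
Lemma matching_sum_contract e s A W :
  e.1 != e.2 -> e.1 \notin W -> e.2 \notin W ->
  matching_sum s A W - matching_sum s (A - (incidence e)^T *m incidence e) W
    - matching_sum s A (e.1 |: (e.2 |: W))
  = matching_sum (map (merge_edge e) s) (contract e A) W.
Proof.
move=> uv; elim: s W => [|f s IH] W uW vW /=; first exact: pminor_contract.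
set A' := A - _ in IH *.
have both (Y : {set _}) : e.1 \in Y -> e.2 \in Y ->
    matching_sum s A' Y = matching_sum s A Y.
  move=> uY vY; apply: eq_matching_sum => i j iY jY.
  rewrite !mxE big1 ?subr0 // => k _; rewrite !mxE.
  have ne w : w \in Y -> (i == w) = false by move=> wY; apply: contraNF iY => /eqP->.
  by rewrite !ne // andbF subrr mul0r.
(* Here [a], [b], [c] are the sums without [f], settled by induction, and [x1] to [x4] the sums
   through [f]. *)
suff step : forall a b c x1 x2 x3 x4 : K, x1 - x2 - x3 = x4 ->
    a + x1 - (b + x2) - (c + x3) = a - b - c + x4.
  rewrite -IH //; apply: step.
  pose uv_ x := (x == e.1) || (x == e.2).
  have mergeW x : (merge_vertex e x \notin W) = uv_ x || (x \notin W).
    rewrite /merge_vertex /uv_; case: (eqVneq x e.2) => [_|_]; first by rewrite orbT uW.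
    by rewrite orbF; case: eqP => // ->; rewrite uW.
  have merge_uv x : uv_ x -> merge_vertex e x = e.1.
    by rewrite /uv_ /merge_vertex; case: (eqVneq x e.2) => // _; rewrite orbF => /eqP.
  have merge_nuv x : ~~ uv_ x -> merge_vertex e x = x.
    by rewrite /uv_ /merge_vertex negb_or; case: (eqVneq x e.2) => //; rewrite andbF.
  have uvW x : uv_ x -> x \notin W by case/orP => /eqP ->.
  have in3 x : (x \notin e.1 |: (e.2 |: W)) = ~~ uv_ x && (x \notin W).
    by rewrite !in_setU1 orbA negb_or.
  have half x y : uv_ x -> ~~ uv_ y -> y \notin W ->
      matching_sum s A (x |: (y |: W)) - matching_sum s A' (x |: (y |: W))
      = matching_sum (map (merge_edge e) s) (contract e A) (e.1 |: (y |: W)).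
    move=> ux; rewrite /uv_ negb_or => /andP[yu yv] yW.
    have := ux; rewrite /uv_ => xuv; rewrite matching_sum_merge_covered ?setU11 //.
    rewrite matching_sum_half //; last first.
      rewrite !inE (negPf uW) (negPf vW) ![_ == y]eq_sym (negPf yu) (negPf yv) !orbF.
      by case/orP: xuv => /eqP ->; rewrite eqxx ?[e.2 == _]eq_sym (negPf uv).
    congr matching_sum; apply/setP => z; rewrite !inE.
    by case/orP: xuv => /eqP ->; case: (z == e.1); case: (z == e.2).
  rewrite !mergeW !in3.
  case: (boolP (uv_ f.1)) => ux; case: (boolP (uv_ f.2)) => uy.
  - rewrite !uvW //= !merge_uv // eqxx /= !andbT andbF subr0.
    case: ifP => [xy|_]; last by rewrite subrr.
    suff [xin yin] : e.1 \in f.1 |: (f.2 |: W) /\ e.2 \in f.1 |: (f.2 |: W).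
      by rewrite both ?subrr.
    by case/orP: ux xy => /eqP ->; case/orP: uy => /eqP ->;
       rewrite ?eqxx // !inE !eqxx !orbT.
  - have xy : f.1 != f.2 by apply: contraNneq uy => <-.
    rewrite (uvW _ ux) xy merge_uv // merge_nuv //= ?andbF subr0.
    have -> : e.1 != f.2 by apply: contraNneq uy => <-; rewrite /uv_ eqxx.
    by case: ifP => [yW|]; rewrite ?subrr // half.
  - have xy : f.1 != f.2 by apply: contraNneq ux => ->.
    rewrite (uvW _ uy) xy merge_nuv // merge_uv //= ?andbF subr0 ?andbT.
    have -> : f.1 != e.1 by apply: contraNneq ux => ->; rewrite /uv_ eqxx.
    by case: ifP => [yW|]; rewrite ?subrr // ![f.1 |: (_ |: W)]setUCA half.
  rewrite !merge_nuv //=; case: ifP => [/and3P[xy xW yW]|]; last by rewrite !subrr.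
  move: (ux) (uy); rewrite /uv_ !negb_or => /andP[xu xv] /andP[yu yv].
  rewrite -IH; first congr (_ - matching_sum _ _ _).
  - by apply/setP => z; rewrite !inE; case: (z == f.1); case: (z == f.2); rewrite ?orbT.
  - by rewrite !inE ![e.1 == _]eq_sym (negPf xu) (negPf yu).
  - by rewrite !inE ![e.2 == _]eq_sym (negPf xv) (negPf yv).
by move=> a b c x1 x2 x3 x4 <-; ring.
Qed.

(** Matchings through [e] freeze both of its ends, so its Laplacian term may be dropped from them;
    [matching_sum_contract] then gives deletion-contraction. *)
Lemma matching_sum_cons_laplacian e s : e.1 != e.2 ->
  matching_sum (e :: s) (1%:M - laplacian (e :: s)) set0 =
  matching_sum s (1%:M - laplacian s) set0 -
  matching_sum (map (merge_edge e) s) (1%:M - laplacian (map (merge_edge e) s)) set0.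
Proof.
move=> uv; rewrite -contract_laplacian -matching_sum_contract ?inE //=.
rewrite !inE uv /= /laplacian big_cons opprD addrA.
have -> : 1%:M - (incidence e)^T *m incidence e
    - \sum_(f <- s) (incidence f)^T *m incidence f
  = 1%:M - \sum_(f <- s) (incidence f)^T *m incidence f
    - (incidence e)^T *m incidence e.
  by rewrite addrAC.
set A := _ - \sum_(f <- s) _.
have -> : matching_sum s A (e.1 |: (e.2 |: set0)) =
          matching_sum s (A - (incidence e)^T *m incidence e) (e.1 |: (e.2 |: set0)).
  apply: eq_matching_sum => i j; rewrite !inE orbF negb_or => /andP[/negPf iu /negPf iv] _.
  by rewrite [RHS]mxE [X in _ + X]mxE [X in _ - X]mxE big1 ?subr0 // => k _;
     rewrite !mxE iu iv andbF subrr mul0r.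
by ring.
Qed.

Lemma matching_sum_cons_loop e s : e.1 = e.2 ->
  matching_sum (e :: s) (1%:M - laplacian (e :: s)) set0 =
  matching_sum s (1%:M - laplacian s) set0.
Proof.
move=> uv; rewrite /= uv eqxx addr0 /laplacian big_cons /incidence uv subrr.
by rewrite mulmx0 add0r.
Qed.
End DeletionContraction.

(** * Forests *)

Section Forests.
Variables (F : fieldType) (K : comNzRingType) (d : nat).
Implicit Types (e f : 'I_d * 'I_d) (s B : seq ('I_d * 'I_d)).

(** Linear independence in the graphic matroid: a loop has zero vector and parallel edges have
    proportional ones, so multigraphs, which contraction produces, are handled correctly. *)
Definition acyclic B := free [seq incidence F e | e <- B].

(** [B] holds the edges already chosen; the sign counts only those taken from [s]. *)
Fixpoint forest_sum B s : K :=
  if s is e :: s' then forest_sum B s' - forest_sum (e :: B) s'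
  else (acyclic B)%:R.

Lemma perm_forest_sum B B' s : perm_eq B B' -> forest_sum B s = forest_sum B' s.
Proof.
elim: s B B' => [|e s IH] B B' eqB /=.
  by congr (_%:R); congr nat_of_bool; apply/perm_free/perm_map.
by congr (_ - _); apply: IH; rewrite ?perm_cons.
Qed.

(** Rank-nullity for the merging map [pi]: its kernel is the line of [incidence e], so the span
    loses one dimension while the list loses one vector. *)
Lemma acyclic_merge e B : e.1 != e.2 ->
  acyclic (e :: B) = acyclic (map (merge_edge e) B).
Proof.
move=> uv; rewrite /acyclic /=; set X := map _ B.
pose pi := linfun (mulmxr (merge_mx F e)) : 'Hom('rV[F]_d, 'rV[F]_d).
have piE x : pi x = x *m merge_mx F e by rewrite lfunE.
have -> : [seq incidence F f | f <- map (merge_edge e) B] = map pi X.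
  by rewrite -!map_comp; apply: eq_map => f /=; rewrite incidence_merge piE.
have pi_e : pi (incidence F e) = 0.
  by rewrite piE -incidence_merge /incidence /= /merge_vertex (negPf uv) eqxx subrr.
have e_neq0 : incidence F e != 0.
  apply: contraNneq (oner_neq0 F) => /rowP/(_ e.1).
  by rewrite !mxE !eqxx (negPf uv) /= subr0 => /eqP.
have ker : (<<incidence F e :: X>> :&: lker pi = <[incidence F e]>)%VS.
  apply/eqP; rewrite eqEsubv; apply/andP; split.
    apply/subvP => x /memv_capP[_]; rewrite memv_ker piE /merge_mx.
    rewrite mulmxBr mulmxDr mulmx1 -addrA -mulmxBr => /eqP/(canRL (addrK _)).
    (* Merging adds to [x] its coordinate at [e.2] times [incidence e], so a vanishing image
       determines the coefficient. *)
    rewrite add0r => ->; apply/vlineP; exists (- x 0 e.2); apply/rowP => j.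
    rewrite !mxE (bigD1 e.2) //= big1 => [|k /negPf ke]; last first.
      by rewrite !mxE ke subrr mulr0.
    by rewrite !mxE !eqxx addr0 mulNr.
  rewrite subv_cap -!memvE memv_ker pi_e eqxx andbT.
  by apply: memv_span; rewrite mem_head.
have := limg_ker_dim pi <<incidence F e :: X>>.
rewrite ker dim_vline e_neq0 limg_span /= pi_e span_cons.
have -> : (<[0 : 'rV[F]_d]> + <<map pi X>> = <<map pi X>>)%VS.
  by apply/addv_idPr; rewrite -memvE mem0v.
by rewrite /free /= size_map => <-; rewrite eqSS.
Qed.

Lemma forest_sum_contract e s B B' : e.1 != e.2 -> perm_eq B (e :: B') ->
  forest_sum B s = forest_sum (map (merge_edge e) B') (map (merge_edge e) s).
Proof.
move=> uv; elim: s B B' => [|f s IH] B B' eqB /=.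
  congr (_%:R); congr nat_of_bool; rewrite -acyclic_merge //.
  exact/perm_free/perm_map.
congr (_ - _); first exact: IH.
rewrite -/(map _ (f :: B')); apply: IH.
rewrite -(perm_cons f) in eqB; apply: perm_trans eqB _.
by apply/seq.permP => p /=; rewrite addnCA.
Qed.

Lemma forest_sum_loop e s B : e.1 = e.2 -> e \in B -> forest_sum B s = 0.
Proof.
move=> uv; elim: s B => [|f s IH] B eB /=; last first.
  by rewrite !IH ?subrr // in_cons eB orbT.
suff /negPf -> : ~~ acyclic B by [].
apply/negP => /free_not0; move=> /(_ (incidence F e)).
by rewrite map_f // => /(_ isT); rewrite /incidence uv subrr eqxx.
Qed.

(** Both sides obey the same deletion-contraction and ignore loops. The induction is on the length,
    since the contracted list is a relabelling of the tail rather than the tail. *)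
Theorem forest_sum_matching s :
  forest_sum [::] s = matching_sum s (1%:M - laplacian K s) set0.
Proof.
have [k] := ubnP (size s); elim: k s => // k IH [_|e s /ltnSE le_k].
  by rewrite /= /acyclic nil_free /pminor freeze0 /laplacian big_nil subr0 det1.
have [uv|uv] := eqVneq e.1 e.2.
  by rewrite matching_sum_cons_loop //= (@forest_sum_loop e s [:: e]) ?mem_head // subr0 IH.
rewrite matching_sum_cons_laplacian //= -!IH ?size_map //.
by rewrite (@forest_sum_contract e s [:: e] [::]).
Qed.

End Forests.

(* [g] enumerates the subsets of [T] by deciding one element after the other *)
Lemma sum_subsets_rec (T : finType) (K : nmodType) (f : {set T} -> K)
    (g : seq T -> {set T} -> K) :
    (forall A, g [::] A = f A) ->
    (forall e s (A : {set T}), e \notin A -> g (e :: s) A = g s A + g s (e |: A)) ->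
  g (enum T) set0 = \sum_A f A.
Proof.
move=> g0 gS.
suff main s (A : {set T}) : uniq s -> [disjoint A & s] ->
    g s A = \sum_(B : {set T} | (A \subset B) && (B \subset A :|: [set x in s])) f B.
  rewrite main ?enum_uniq // ?disjoints0 //; last first.
    by apply/pred0P => x /=; rewrite inE.
  apply: eq_bigl => B; rewrite sub0set set0U.
  by apply/subsetP => x _; rewrite inE mem_enum.
elim: s A => [|e s IH] A /=.
  move=> _ _; rewrite g0 (big_pred1 A) // => B /=; rewrite [in RHS]eqEsubset andbC.
  suff -> : A :|: [set x in [::]] = A by [].
  by apply/setP => x; rewrite !inE orbF.
case/andP => es us; rewrite disjoint_sym disjoint_cons disjoint_sym => /andP[eA dA].
rewrite gS // !IH //; last first.
  apply/pred0P => x /=; rewrite !inE; case: eqP => [->|_] /=; first exact/negbTE.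
  by have /pred0P/(_ x) := dA.
rewrite [RHS](bigID (fun B : {set T} => e \in B)) [RHS]addrC /=.
congr (_ + _); apply: eq_bigl => B.
  rewrite -andbA; congr (_ && _); apply/idP/andP => [sB|[/subsetP sB eB]].
    split.
      by apply: subset_trans sB _; apply/setUS/subsetP => x; rewrite !inE orbC => ->.
    apply: contra es => /(subsetP sB); rewrite !inE.
    by rewrite (negPf eA).
  apply/subsetP => x xB; have := sB _ xB; rewrite !inE.
  by case: eqP => // xe; rewrite -xe xB in eB.
have -> : A :|: [set x in e :: s] = (e |: A) :|: [set x in s].
  by apply/setP => x; rewrite !inE orbCA orbA.
by rewrite subUset sub1set [RHS]andbC andbA.
Qed.

(** * Matchings of complete bipartite graphs *)

Lemma sum_acyclic_sets (F : fieldType) (K : comNzRingType) (d : nat)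
    (E : finType) (h : E -> 'I_d * 'I_d) :
  \sum_(A : {set E}) (-1) ^+ #|A| * (acyclic F (map h (enum A)))%:R
  = forest_sum F K [::] (map h (enum E)).
Proof.
(* The factor restores the sign of the edges in [A], which [forest_sum] leaves out. *)
pose g s (A : {set E}) : K := (-1) ^+ #|A| * forest_sum F K (map h (enum A)) (map h s).
rewrite -(sum_subsets_rec (g := g)) /g ?cards0 ?mul1r ?enum_set0 // => e s A eA /=.
rewrite cardsU1 eA add1n exprS mulrBr mulN1r mulNr; congr (_ - _ * _).
apply: perm_forest_sum; rewrite -map_cons; apply/perm_map/uniq_perm.
- by rewrite /= mem_enum eA enum_uniq.
- exact: enum_uniq.
by move=> x; rewrite in_cons !mem_enum !inE.
Qed.

Section BipartiteMatchings.
Variables m n : nat.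
Implicit Types (M : {set 'I_m * 'I_n}) (e : 'I_m * 'I_n).

Definition bip_edge e : 'I_(m + n) * 'I_(m + n) := (lshift n e.1, rshift m e.2).

Definition covered M : {set 'I_(m + n)} :=
  [set lshift n p.1 | p in M] :|: [set rshift m p.2 | p in M].

Lemma lshift_covered M i : (lshift n i \notin covered M) = [forall p in M, p.1 != i].
Proof.
rewrite inE negb_or andbC.
have /negPf -> /= : lshift n i \notin [set rshift m p.2 | p in M].
  by apply/imsetP => -[p _] /eqP; rewrite eq_lrshift.
apply/idP/forall_inP => [H p pM|H].
  by apply: contra H => /eqP <-; apply: imset_f.
by apply/imsetP => -[p pM] /lshift_inj eqi; have := H p pM; rewrite -eqi eqxx.
Qed.

Lemma rshift_covered M j : (rshift m j \notin covered M) = [forall p in M, p.2 != j].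
Proof.
rewrite inE negb_or; have /negPf -> /= : rshift m j \notin [set lshift n p.1 | p in M].
  by apply/imsetP => -[p _] /eqP; rewrite eq_rlshift.
apply/idP/forall_inP => [H p pM|H].
  by apply: contra H => /eqP <-; apply: imset_f.
by apply/imsetP => -[p pM] /rshift_inj eqi; have := H p pM; rewrite -eqi eqxx.
Qed.

Lemma coveredU1 e M :
  covered (e |: M) = lshift n e.1 |: (rshift m e.2 |: covered M).
Proof. by rewrite /covered !imsetU1 setUACA -setUA. Qed.

Lemma is_matchingP M : reflect
  (forall p q, p \in M -> q \in M -> p != q -> (p.1 != q.1) && (p.2 != q.2))
  (is_matching M).
Proof.
apply: (iffP forall_inP) => [H p q pM qM pq|H p pM].
  by move/forall_inP: (H p pM) => /(_ q qM); rewrite pq.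
by apply/forall_inP => q qM; apply/implyP; apply: H.
Qed.

Lemma is_matchingU1 e M : e \notin M -> is_matching (e |: M) =
  [&& is_matching M, lshift n e.1 \notin covered M & rshift m e.2 \notin covered M].
Proof.
move=> eM; rewrite lshift_covered rshift_covered.
have ne p : p \in M -> p != e by apply: contraTneq => ->.
apply/is_matchingP/and3P => [H|[/is_matchingP H /forall_inP H1 /forall_inP H2] p q].
  split; [apply/is_matchingP => p q pM qM; apply: H; exact: setU1r | |].
    by apply/forall_inP => p pM; have /andP[] := H _ _ (setU1r e pM) (setU11 _ _) (ne _ pM).
  by apply/forall_inP => p pM; have /andP[] := H _ _ (setU1r e pM) (setU11 _ _) (ne _ pM).
rewrite !in_setU1 => /predU1P[->|pM] /predU1P[->|qM]; rewrite ?eqxx // => pq.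
- by rewrite [e.1 == _]eq_sym [e.2 == _]eq_sym H1 ?H2.
- by rewrite H1 ?H2.
- exact: H.
Qed.

Lemma matching_sum_bip (K : comNzRingType) (A : 'M[K]_(m + n)) :
  matching_sum (map bip_edge (enum {: 'I_m * 'I_n})) A set0
  = \sum_(M : {set 'I_m * 'I_n} | is_matching M) pminor (covered M) A.
Proof.
pose g s M := if is_matching M then matching_sum (map bip_edge s) A (covered M) else 0.
have -> : matching_sum (map bip_edge (enum {: 'I_m * 'I_n})) A set0
          = g (enum {: 'I_m * 'I_n}) set0.
  rewrite /g /covered !imset0 setU0 ifT //.
  by apply/is_matchingP => p q; rewrite inE.
rewrite (sum_subsets_rec (f := fun M => if is_matching M then pminor (covered M) A else 0)).
- by rewrite -big_mkcond.
- by [].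
move=> e s M eM; rewrite /g is_matchingU1 // coveredU1 /=.
by case: ifP => //= _; rewrite ?addr0 // eq_lrshift.
Qed.

Lemma card_uncovered1 M : is_matching M -> (uncovered1 M + #|M| = m)%N.
Proof.
move=> /is_matchingP H; rewrite /uncovered1.
have <- : #|[set p.1 | p in M]| = #|M|.
  rewrite card_in_imset // => p q pM qM eq1; apply/eqP; apply: contraT => /(H p q pM qM).
  by rewrite eq1 eqxx.
have -> : [set i | [forall p in M, p.1 != i]] = ~: [set p.1 | p in M].
  apply/setP => i; rewrite !inE; apply/forall_inP/negP => [K /imsetP[p pM ip]|K p pM].
    by have := K p pM; rewrite ip eqxx.
  by apply/eqP => ip; apply: K; apply/imsetP; exists p.
by rewrite cardsCs setCK card_ord subnK // -[X in (_ <= X)%N]card_ord max_card.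
Qed.

Lemma card_uncovered2 M : is_matching M -> (uncovered2 M + #|M| = n)%N.
Proof.
move=> /is_matchingP H; rewrite /uncovered2.
have <- : #|[set p.2 | p in M]| = #|M|.
  rewrite card_in_imset // => p q pM qM eq1; apply/eqP; apply: contraT => /(H p q pM qM).
  by rewrite eq1 eqxx andbF.
have -> : [set i | [forall p in M, p.2 != i]] = ~: [set p.2 | p in M].
  apply/setP => i; rewrite !inE; apply/forall_inP/negP => [K /imsetP[p pM ip]|K p pM].
    by have := K p pM; rewrite ip eqxx.
  by apply/eqP => ip; apply: K; apply/imsetP; exists p.
by rewrite cardsCs setCK card_ord subnK // -[X in (_ <= X)%N]card_ord max_card.
Qed.

Definition nmatchings (k : nat) :=
  #|[set M : {set 'I_m * 'I_n} | is_matching M && (#|M| == k)]|.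

(* Double counting of the pairs of a (k+1)-matching and one of its edges. *)
Lemma nmatchingsS k : (k.+1 * nmatchings k.+1 = nmatchings k * ((m - k) * (n - k)))%N.
Proof.
have lhs : (\sum_(M : {set 'I_m * 'I_n} | is_matching M && (#|M| == k.+1)) \sum_(e in M) 1
            = k.+1 * nmatchings k.+1)%N.
  rewrite (eq_bigr (fun=> k.+1)) => [|M /andP[_ /eqP <-]]; last by rewrite sum1_card.
  by rewrite sum_nat_const mulnC /nmatchings cardsE.
have rhs : (\sum_(M : {set 'I_m * 'I_n} | is_matching M && (#|M| == k))
     \sum_(e | (lshift n e.1 \notin covered M) && (rshift m e.2 \notin covered M)) 1
     = nmatchings k * ((m - k) * (n - k)))%N.
  rewrite (eq_bigr (fun=> ((m - k) * (n - k))%N)) => [|M /andP[mM /eqP <-]]; last first.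
    have -> : (m - #|M| = uncovered1 M)%N by have := card_uncovered1 mM; lia.
    have -> : (n - #|M| = uncovered2 M)%N by have := card_uncovered2 mM; lia.
    rewrite /uncovered1 /uncovered2 -cardsX sum1_card; apply: eq_card => e.
    by rewrite [LHS]unfold_in /= lshift_covered rshift_covered !inE.
  by rewrite sum_nat_const /nmatchings cardsE.
rewrite -lhs -rhs !pair_big_dep /=.
rewrite (reindex_onto (fun Me : {set 'I_m * 'I_n} * _ => (Me.2 |: Me.1, Me.2))
           (fun Me => (Me.1 :\ Me.2, Me.2))) /=; last first.
  by case=> M e /= /andP[_ eM]; rewrite setD1K.
apply: eq_bigl => -[M e] /=; rewrite setU11 andbT xpair_eqE eqxx andbT.
case: (boolP (e \in M)) => eM.
  have -> : (e |: M) :\ e == M = false.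
    by apply/eqP => /setP/(_ e); rewrite !inE eqxx eM.
  rewrite andbF; apply/esym/negP => /and3P[_]; rewrite lshift_covered => /forall_inP.
  by move/(_ e eM); rewrite eqxx.
rewrite setU1K // eqxx andbT is_matchingU1 // cardsU1 eM add1n eqSS -!andbA.
by do !bool_congr.
Qed.

Lemma card_nmatchings k : nmatchings k = ('C(m, k) * n ^_ k)%N.
Proof.
elim: k => [|k IH].
  rewrite bin0 ffactn0 /nmatchings (_ : [set M | _] = [set set0]) ?cards1 //.
  apply/setP => M; rewrite !inE cards_eq0; case: eqP => [->|]; rewrite ?andbF // andbT.
  by apply/is_matchingP => p q; rewrite inE.
apply/eqP; rewrite -(eqn_pmul2l (ltn0Sn k)) nmatchingsS IH; apply/eqP.
by rewrite [in RHS]mulnA mul_bin_left ffactnSr mulnACA [(_ * (m - k))%N]mulnC.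
Qed.

End BipartiteMatchings.

(** * Bipartite Hermite polynomials *)

Section Hermite.
Variables (K : comNzRingType) (x y : K).
Implicit Types a b k : nat.

(* When [k > b] the truncated exponent is harmless, since [b ^_ k = 0]. *)
Definition herm_term a b k : K := ('C(a, k) * b ^_ k)%:R * (x ^+ (a - k) * y ^+ (b - k)).

(** The bipartite Hermite polynomial grouped by the number [k] of edges, with the count of
    [k]-matchings in closed form and values in any commutative ring. *)
Definition herm a b : K := \sum_(k < a.+1) herm_term a b k.

(** Matchings with a marked edge: there are [a.+1 * b.+1] choices for it, and removing its ends
    leaves a matching of the smaller graph. *)
Lemma herm_term_marked a b k :
  k.+1%:R * herm_term a.+1 b.+1 k.+1 = (a.+1 * b.+1)%:R * herm_term a b k.
Proof.
rewrite /herm_term !subSS !mulrA -!natrM; congr (_%:R * _ * _).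
by rewrite mulnA -mul_bin_diag ffactSS /= mulnACA.
Qed.

Lemma herm_marked a b :
  \sum_(k < a.+2) k%:R * herm_term a.+1 b.+1 k = (a.+1 * b.+1)%:R * herm a b.
Proof.
rewrite big_ord_recl mul0r add0r /herm mulr_sumr.
by apply: eq_bigr => k _; rewrite herm_term_marked.
Qed.

(** A vertex of the first part is uncovered or matched to one of [b.+1] vertices; on coefficients
    this is Pascal's rule. *)
Lemma herm_recl a b : herm a.+1 b.+1 = x * herm a b.+1 + b.+1%:R * herm a b.
Proof.
have termS k : herm_term a.+1 b.+1 k.+1 =
    x * herm_term a b.+1 k.+1 + b.+1%:R * herm_term a b k.
  rewrite /herm_term !subSS binS mulnDl natrD mulrDl; congr (_ + _); last first.
    by rewrite ffactSS !mulrA -!natrM; congr (_%:R * _ * _); rewrite mulnCA.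
  have [ka|ka] := ltnP k a; last by rewrite bin_small // mul0n !mul0r mulr0.
  by rewrite -[(a - k)%N]subnSK // exprS; ring.
rewrite /herm [LHS]big_ord_recl; under [X in _ + X = _]eq_bigr do rewrite lift0 termS.
rewrite big_split /= -!mulr_sumr.
rewrite addrA; congr (_ + _); rewrite [in RHS]big_ord_recl [in RHS]mulrDr.
congr (_ + _).
  by rewrite /herm_term !bin0 !ffactn0 !subn0 exprS; ring.
rewrite big_ord_recr /= {2}/herm_term bin_small // mul0n mul0r addr0.
by congr (_ * _); apply: eq_bigr.
Qed.

Lemma ffactSSr b k : (b.+1 ^_ k.+1 = b ^_ k.+1 + k.+1 * b ^_ k)%N.
Proof.
rewrite ffactSS ffactnSr [(b ^_ k * _)%N]mulnC -mulnDl.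
have [kb|kb] := leqP k b; last by rewrite ffact_small // !muln0.
by congr (_ * _)%N; lia.
Qed.

(** The same dichotomy in the second part. The coefficients are not visibly symmetric, so [ffactSSr]
    replaces Pascal's rule. *)
Lemma herm_recr a b : herm a.+1 b.+1 = y * herm a.+1 b + a.+1%:R * herm a b.
Proof.
have termS k : herm_term a.+1 b.+1 k.+1 =
    y * herm_term a.+1 b k.+1 + a.+1%:R * herm_term a b k.
  rewrite /herm_term !subSS ffactSSr mulnDr natrD mulrDl; congr (_ + _); last first.
    rewrite !mulrA -!natrM; congr (_%:R * _ * _).
    by rewrite mulnCA mulnA -mul_bin_diag -mulnA.
  have [kb|kb] := ltnP k b; last by rewrite ffact_small // muln0 !mul0r mulr0.
  by rewrite -[(b - k)%N]subnSK // exprS; ring.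
rewrite /herm [LHS]big_ord_recl; under [X in _ + X = _]eq_bigr do rewrite lift0 termS.
rewrite big_split /= -!mulr_sumr.
rewrite addrA; congr (_ + _); rewrite [in RHS]big_ord_recl [in RHS]mulrDr.
congr (_ + _).
by rewrite /herm_term !bin0 !ffactn0 !subn0 (exprS y); ring.
Qed.

End Hermite.

(* The relation mn - xy - n = y, for m = a+2 and n = b+2, is what makes the
   recurrences collapse. *)
Lemma herm_defect (K : comNzRingType) (a b : nat) :
  let x : K := b.+1%:R in let y : K := a.+1%:R in
  (a.+2 * b.+2)%:R * herm x y a.+1 b.+1 - herm x y a.+2 b.+2 = x * y * herm x y a b.
Proof.
move=> x y; rewrite (herm_recl x y a.+1) (herm_recr x y a b.+1).
rewrite (herm_recl x y a b) natrM -(natr1 a.+1) -(natr1 b.+1) -/x -/y.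
ring.
Qed.

Lemma sum_matchings (K : nmodType) (m n : nat) (f : nat -> K) :
  \sum_(M : {set 'I_m * 'I_n} | is_matching M) f #|M|
  = \sum_(k < m.+1) f k *+ ('C(m, k) * n ^_ k).
Proof.
rewrite (partition_big (fun M : {set 'I_m * 'I_n} => inord #|M| : 'I_m.+1) predT) //=.
apply: eq_bigr => k _; rewrite -card_nmatchings /nmatchings cardsE -sumr_const.
rewrite (eq_bigl (fun M : {set 'I_m * 'I_n} => is_matching M && (#|M| == k))).
  by apply: eq_bigr => M /andP[_ /eqP ->].
move=> M; case: (boolP (is_matching M)) => //= mM.
by rewrite -val_eqE /= inordK // ltnS -[X in (_ <= X)%N](card_uncovered1 mM) leq_addl.
Qed.

Lemma bip_hermite_herm (a b : nat) (x y : int) :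
  (bip_hermite a b).[x, y] = herm x y a b.
Proof.
rewrite bip_hermite_horner.
rewrite (eq_bigr (fun M : {set 'I_a * 'I_b} =>
  x ^+ (a - #|M|) * y ^+ (b - #|M|))); last first.
  move=> M mM; have h1 := card_uncovered1 mM; have h2 := card_uncovered2 mM.
  by congr (_ ^+ _ * _ ^+ _); lia.
rewrite (sum_matchings _ _ (fun k => x ^+ (a - k) * y ^+ (b - k))).
by apply: eq_bigr => k _; rewrite /herm_term -[in LHS]mulr_natl.
Qed.

(** The [k]-th summand is the minor left by a [k]-matching. Its second term carries the number of
    ways to add an edge, so it moves to index [k.+1] as a count of matchings with a marked edge, and
    [herm_marked] sums it. *)
Lemma sum_signed_matchings (K : comNzRingType) (a b : nat) (x y : K) :
  \sum_(k < a.+2) ((- x) ^+ (a.+1 - k) * (- y) ^+ (b.+1 - k)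
     - ((a.+1 - k) * (b.+1 - k))%:R *
       ((- x) ^+ (a.+1 - k).-1 * (- y) ^+ (b.+1 - k).-1)) *+ ('C(a.+1, k) * b.+1 ^_ k)
  = (-1) ^+ (a + b) * (herm x y a.+1 b.+1 - (a.+1 * b.+1)%:R * herm x y a b).
Proof.
rewrite -herm_marked [X in _ - X]big_ord_recl mul0r add0r.
(* The extra last term has a vanishing binomial coefficient and aligns the two ranges. *)
have -> : \sum_(i < a.+1) (lift ord0 i)%:R * herm_term x y a.+1 b.+1 (lift ord0 i)
          = \sum_(k < a.+2) k.+1%:R * herm_term x y a.+1 b.+1 k.+1.
  rewrite [RHS]big_ord_recr /= {3}/herm_term bin_small // mul0n mul0r mulr0 addr0.
  exact: eq_bigr.
rewrite -sumrB mulr_sumr; apply: eq_bigr => k _.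
have ka : (k <= a.+1)%N by rewrite -ltnS.
have [kb|kb] := leqP k b.+1; last first.
  rewrite ffact_small // muln0 mulr0n /herm_term !ffact_small ?muln0 //; last by lia.
  by rewrite !mul0r mulr0 subrr mulr0.
have E : (k.+1 * ('C(a.+1, k.+1) * b.+1 ^_ k.+1)
          = (a.+1 - k) * (b.+1 - k) * ('C(a.+1, k) * b.+1 ^_ k))%N.
  by rewrite mulnA mul_bin_left ffactnSr [(b.+1 ^_ k * _)%N]mulnC mulnACA.
rewrite /herm_term [X in _ * (_ - X)]mulrA -natrM E !subnS.
(* Both exponents drop together as [k] grows, so the parity of their sum is constant. *)
have sgn : (-1) ^+ (a + b) = (-1) ^+ (a.+1 - k) * (-1) ^+ (b.+1 - k) :> K.
  rewrite -exprD -signr_odd -[RHS]signr_odd.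
  by congr (_ ^+ nat_of_bool _); lia.
rewrite !(exprNn x) !(exprNn y) sgn.
move: (a.+1 - k)%N (b.+1 - k)%N ('C(a.+1, k) * b.+1 ^_ k)%N => p q c.
rewrite -mulr_natl.
case: p => [|p]; first by rewrite !mul0n; ring.
case: q => [|q]; first by rewrite !muln0 mul0n; ring.
rewrite !exprS /= natrM; ring.
Qed.

(** * The Laplacian of a complete bipartite graph *)

(** Factoring out the diagonal [D], which needs division by [x] and [y], leaves off-diagonal blocks
    of rank one; two determinant swaps then reduce to the scalar [1 - (b / y) (a / x)]. If [a] or
    [b] is 0, the truncated exponents come with a zero factor. *)
Lemma pminor_bip_block (K : fieldType) (m n : nat) (x y : K) (W : {set 'I_(m + n)})
    (a := #|[set i : 'I_m | lshift n i \notin W]|)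
    (b := #|[set j : 'I_n | rshift m j \notin W]|) :
  x != 0 -> y != 0 ->
  pminor W (block_mx x%:M (const_mx 1) (const_mx 1) y%:M)
  = x ^+ a * y ^+ b - (a * b)%:R * (x ^+ a.-1 * y ^+ b.-1).
Proof.
move=> x0 y0.
pose u : 'cV[K]_m := \col_i ((lshift n i \notin W)%:R / x).
pose v : 'cV[K]_n := \col_j ((rshift m j \notin W)%:R / y).
pose D := diag_mx (row_mx (\row_i (if lshift n i \in W then 1 else x))
                          (\row_j (if rshift m j \in W then 1 else y))).
have -> : pminor W (block_mx x%:M (const_mx 1) (const_mx 1) y%:M) =
    \det (D *m block_mx 1%:M (u *m const_mx 1) (v *m const_mx 1) 1%:M).
  rewrite /pminor; congr (\det _); apply/matrixP => i j.
  rewrite mul_diag_mx [LHS]mxE [RHS]mxE.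
  case: (splitP i) => i' Ei; [have {Ei i} -> : i = lshift n i' by apply: val_inj
                             |have {Ei i} -> : i = rshift m i' by apply: val_inj];
  (case: (splitP j) => j' Ej; [have {Ej j} -> : j = lshift n j' by apply: val_inj
                              |have {Ej j} -> : j = rshift m j' by apply: val_inj]);
  rewrite ?block_mxEul ?block_mxEur ?block_mxEdl ?block_mxEdr ?row_mxEl ?row_mxEr.
  - by rewrite !mxE eq_lshift; case: ifP => _; rewrite ?mul1r // mulr_natr.
  - rewrite !mxE eq_lrshift big_ord1 !mxE.
    by case: ifP => _ /=; rewrite ?mul0r ?mulr0 // mulr1 mul1r divff.
  - rewrite !mxE eq_rlshift big_ord1 !mxE.
    by case: ifP => _ /=; rewrite ?mul0r ?mulr0 // mulr1 mul1r divff.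
  by rewrite !mxE eq_rshift; case: ifP => _; rewrite ?mul1r // mulr_natr.
rewrite det_mulmx det_block_mx1 det_diag big_split_ord /=.
have prodE p (P : pred 'I_p) (z : K) :
    \prod_i (if P i then 1 else z) = z ^+ #|[set i | ~~ P i]|.
  rewrite (eq_bigr (fun i => if ~~ P i then z else 1)) => [|i _]; last by case: (P i).
  by rewrite -big_mkcond prodr_const cardsE.
under eq_bigr do rewrite row_mxEl mxE.
under [X in _ * X * _]eq_bigr do rewrite row_mxEr mxE.
rewrite !prodE -/a -/b.
have sumE p (P : pred 'I_p) (z : K) :
    \sum_i (P i)%:R / z = #|[set i | P i]|%:R / z.
  by rewrite -mulr_suml -natr_sum -sum1_card big_mkcond /=; congr (_%:R / _);
     rewrite [RHS]big_mkcond; apply: eq_bigr => i _; rewrite inE; case: (P i).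
rewrite -mulmxA -mulNmx det_1DmulC mulmxN mulmxA.
have cE p (w : 'cV[K]_p) : const_mx 1 *m w = (\sum_i w i 0)%:M :> 'M_1.
  apply/matrixP => i j; rewrite !ord1 !mxE.
  by apply: eq_bigr => k _; rewrite mxE mul1r.
rewrite cE -mulmxA cE -scalar_mxM det_mx11 !mxE eqxx !mulr1n.
have -> : \sum_i u i 0 = a%:R / x by rewrite -sumE; apply: eq_bigr => i _; rewrite mxE.
have -> : \sum_i v i 0 = b%:R / y by rewrite -sumE; apply: eq_bigr => i _; rewrite mxE.
rewrite natrM; move: a b => a b.
case: a => [|a]; first by rewrite !mul0r !subr0 mulr1.
case: b => [|b]; first by rewrite !(mul0r, mulr0) !subr0 mulr1.
by rewrite !exprS /=; field; rewrite x0 y0.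
Qed.

Lemma sum_pairM (K : comNzRingType) (I J : finType) (f : I -> K) (g : J -> K) :
  \sum_(p : I * J) f p.1 * g p.2 = (\sum_i f i) * (\sum_j g j).
Proof. by rewrite big_distrlr pair_big. Qed.

Lemma laplacian_bip (K : comNzRingType) (m n : nat) :
  1%:M - laplacian K (map (@bip_edge m n) (enum {: 'I_m * 'I_n}))
  = block_mx (1 - n%:R)%:M (const_mx 1) (const_mx 1) (1 - m%:R)%:M.
Proof.
have LE i j : laplacian K (map (@bip_edge m n) (enum {: 'I_m * 'I_n})) i j =
    \sum_p incidence K (@bip_edge m n p) 0 i * incidence K (@bip_edge m n p) 0 j.
  rewrite /laplacian big_map big_enum summxE; apply: eq_bigr => p _.
  by rewrite mxE big_ord1 mxE.
have incl p i : incidence K (@bip_edge m n p) 0 (lshift n i) = (i == p.1)%:R.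
  by rewrite !mxE /= eq_lshift eq_lrshift subr0.
have incr p j : incidence K (@bip_edge m n p) 0 (rshift m j) = - (j == p.2)%:R.
  by rewrite !mxE /= eq_rshift eq_rlshift sub0r.
have sum_delta d (i j : 'I_d) : \sum_k (i == k)%:R * (j == k)%:R = (i == j)%:R :> K.
  rewrite (bigD1 i) //= eqxx mul1r big1 ?addr0 1?eq_sym // => k /negPf ki.
  by rewrite eq_sym ki mul0r.
have sum1_delta d (i : 'I_d) : \sum_k (i == k)%:R = 1 :> K.
  by rewrite (bigD1 i) //= eqxx big1 ?addr0 // => k /negPf ki; rewrite eq_sym ki.
apply/matrixP => i j; rewrite [LHS]mxE [X in _ + X]mxE LE.
case: (splitP i) => i' Ei; [have {Ei i} -> : i = lshift n i' by apply: val_inj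
                           |have {Ei i} -> : i = rshift m i' by apply: val_inj];
(case: (splitP j) => j' Ej; [have {Ej j} -> : j = lshift n j' by apply: val_inj
                            |have {Ej j} -> : j = rshift m j' by apply: val_inj]);
rewrite ?block_mxEul ?block_mxEur ?block_mxEdl ?block_mxEdr !mxE;
  rewrite ?eq_lshift ?eq_rshift ?eq_lrshift ?eq_rlshift.
- under eq_bigr do rewrite !incl -[_ * _]mulr1.
  rewrite (sum_pairM (fun k => (i' == k)%:R * (j' == k)%:R) (fun=> 1)).
  by rewrite sum_delta sumr_const card_ord; case: (i' == j'); rewrite ?mul1r ?mul0r ?subr0.
- under eq_bigr do rewrite incl incr mulrN; rewrite sumrN.
  by rewrite (sum_pairM (fun k => (i' == k)%:R) (fun k => (j' == k)%:R));
     rewrite !sum1_delta mulr1 sub0r opprK.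
- under eq_bigr do rewrite incl incr mulNr mulrC; rewrite sumrN.
  by rewrite (sum_pairM (fun k => (j' == k)%:R) (fun k => (i' == k)%:R));
     rewrite !sum1_delta mulr1 sub0r opprK.
under eq_bigr do rewrite !incr mulrNN -[_ * _]mul1r.
rewrite (sum_pairM (fun=> 1) (fun k => (i' == k)%:R * (j' == k)%:R)).
by rewrite sum_delta sumr_const card_ord; case: (i' == j'); rewrite ?mulr1 ?mulr0 ?subr0.
Qed.

(** * Möbius numbers of cographic arrangements *)

(** The equations on [g] determine it by recursion over down-sets, and [mobius] obeys the same
    recursion. *)
Lemma mobius_bot_unique (disp : Order.disp_t) (P : finPOrderType disp) (x : P)
    (g : P -> int) :
    (forall y, (x <= y)%O) ->
    (forall y, \sum_(z | (z <= y)%O) g z = (y == x)%:R) ->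
  forall y, mobius x y = g y.
Proof.
move=> xmin gsum y; have [k] := ubnP #|[set z | (z <= y)%O]|; elim: k y => // k IH y le_k.
have := gsum y; rewrite (bigD1 y) //= mobiusE eq_sym.
case: (eqVneq y x) => [yx|yx].
  rewrite big_pred0 ?addr0 // => z; rewrite yx; apply/negP => /andP[zx].
  by rewrite eq_le zx xmin.
rewrite lt_neqAle eq_sym yx xmin /= => /(canRL (addrK _)); rewrite sub0r => ->.
congr (- _); apply: eq_big => [z|z /andP[_ zy]].
  by rewrite xmin lt_neqAle /= andbC.
apply: IH; rewrite -ltnS; apply: leq_trans le_k; rewrite ltnS; apply: proper_card.
apply/properP; split; last by exists y; rewrite !inE ?lexx // lt_geF.
by apply/subsetP => w; rewrite !inE => /le_trans; apply; apply: ltW.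
Qed.

Lemma sum_sign_subsets (T : finType) (A : {set T}) :
  \sum_(S : {set T} | S \subset A) (-1) ^+ #|S| = (A == set0)%:R :> int.
Proof.
have distr : \prod_i ((if i \in A then -1 else 0) + 1) =
    \sum_(S : {set T} | S \subset A) (-1) ^+ #|S| :> int.
  rewrite bigA_distr [RHS]big_mkcond; apply: eq_bigr => S _.
  case: ifPn => [/subsetP sSA|/subsetPn[i iS iA]]; last first.
    by rewrite (bigD1 i) //= iS (negPf iA) mul0r.
  rewrite -prodr_const [RHS]big_mkcond; apply: eq_bigr => i _.
  by case: ifP => // iS; rewrite sSA.
rewrite -distr; case: eqP => [->|/eqP/set0Pn[i iA]].
  by rewrite big1 // => i _; rewrite inE add0r.
by rewrite (bigD1 i) //= iA addNr mul0r.
Qed.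

Section Crosscut.
Variables (F : fieldType) (vT : vectType F) (E : finType).
Variables (V : {vspace vT}) (H : E -> {vspace vT}).

Lemma flat_elt_le S (y : intersection_lattice V H) :
  (flat_elt V H S <= y)%O = (S \subset [set e | val y <= H e]%VS).
Proof.
change ((val y <= arr_flat V H S)%VS = (S \subset [set e | val y <= H e]%VS)).
have /imageP[A _ Ey] := valP y.
rewrite subv_cap {1}Ey capvSl /=; apply/subv_bigcapP/subsetP => h e eS.
  by rewrite inE h.
by have := h e eS; rewrite inE.
Qed.

(** Group the signed sets [S] by their flat. Those with flat below [y] are the subsets of the set of
    hyperplanes containing [y], so their signs cancel unless that set is empty; by the hypothesis
    this happens exactly at the bottom. *)
Lemma mobius_crosscut :
    (forall e, ~~ (V <= H e)%VS) ->
  mobius (\bot%O : intersection_lattice V H) \top%O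
  = \sum_(S : {set E} | arr_flat V H S == arr_flat V H setT) (-1) ^+ #|S|.
Proof.
move=> VH.
pose g (y : intersection_lattice V H) : int := \sum_(S | flat_elt V H S == y) (-1) ^+ #|S|.
rewrite (mobius_bot_unique (g := g)); first by [].
  by move=> y; apply: Order.le0x.
move=> y.
have -> : \sum_(z | (z <= y)%O) g z = \sum_(S | (flat_elt V H S <= y)%O) (-1) ^+ #|S|.
  rewrite [RHS](partition_big (flat_elt V H) (fun z => (z <= y)%O)) //.
  apply: eq_bigr => z zy; apply: eq_bigl => S.
  by case: eqP => [->|]; rewrite ?andbF ?zy.
under eq_bigl do rewrite flat_elt_le.
rewrite sum_sign_subsets; congr (nat_of_bool _)%:R; apply/eqP/eqP => [A0|->].
  have /imageP[S _ Ey] := valP y; apply: val_inj; rewrite Ey.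
  suff -> : S = set0 by [].
  apply/eqP; rewrite -subset0 -A0 -flat_elt_le.
  by change (val y <= arr_flat V H S)%VS; rewrite Ey.
apply/setP => e; rewrite !inE; apply/negbTE; have := VH e; congr (~~ (_ <= _)%VS).
by change (V = arr_flat V H set0); rewrite /arr_flat big_set0 capvf.
Qed.

End Crosscut.

Section CographicMobius.
Variables (R : realType) (d : nat) (G : digraph d).

Definition ends (e : edge G) := (src e, tgt e).

(** A flow that vanishes on [S] is a linear relation among the edge vectors of the complement. *)
Lemma arr_flat_eq0 (S : {set edge G}) :
  (arr_flat (flow_space R G) (@cographic_hyperplane R d G) S == 0%VS)
  = acyclic R (map ends (enum (~: S))).
Proof.
have memS l : (l \in arr_flat (flow_space R G) (@cographic_hyperplane R d G) S)
    = (l \in flow_space R G) && [forall e in S, l e == 0].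
  rewrite memv_cap; case: (boolP (l \in flow_space R G)) => //= lf.
  apply/idP/forall_inP => [/subv_bigcapP h e eS|h].
    by have := h e eS; rewrite -memvE mem_cographic_hyperplane lf.
  by apply/subv_bigcapP => e eS; rewrite -memvE mem_cographic_hyperplane lf h.
pose X := [tuple @edge_vec R d G (enum_val i) | i < #|~: S|].
have -> : acyclic R (map ends (enum (~: S))) = free X.
  rewrite /acyclic -map_comp; congr free; apply: (@eq_from_nth _ 0).
    by rewrite [RHS]size_tuple size_map -cardE.
  move=> i; rewrite size_map -cardE => lti; pose i' := Ordinal lti.
  have e0 := enum_val i'; rewrite (nth_map e0) -?cardE //.
  by rewrite -[i in RHS]/(nat_of_ord i') -tnth_nth tnth_mktuple (enum_val_nth e0).
have Xi (i : 'I_#|~: S|) : X`_i = edge_vec R (enum_val i).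
  by rewrite -tnth_nth tnth_mktuple.
apply/eqP/freeP => [flat0 k sum0 i | indep].
  (* Extension of [k] by zero: the inner sum has one term off [S] and none on [S]. *)
  pose l : {ffun edge G -> R^o} := [ffun e => \sum_(j | enum_val j == e) k j].
  have lE j : l (enum_val j) = k j.
    by rewrite ffunE (big_pred1 j) // => j'; rewrite /= (inj_eq enum_val_inj).
  have l0 e : e \in S -> l e = 0.
    move=> eS; rewrite ffunE big_pred0 // => j; apply: contraTF eS => /eqP <-.
    by have := enum_valP j; rewrite inE.
  suff /eqP l_eq0 : l == 0 by rewrite -lE l_eq0 ffunE.
  rewrite -memv0 -flat0 memS; apply/andP; split; last first.
    by apply/forall_inP => e /l0 ->.
  rewrite mem_flow_space (bigID (mem (~: S))) /= [X in _ + X]big1 ?addr0; last first.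
    by move=> e; rewrite inE negbK => /l0 ->; rewrite scale0r.
  rewrite big_enum_val -[X in _ == X]sum0; apply/eqP; apply: eq_bigr => j _.
  by rewrite lE Xi.
apply/eqP; rewrite -subv0; apply/subvP => l; rewrite memS => /andP[lf /forall_inP lS].
rewrite memv0; apply/eqP/ffunP => e; rewrite ffunE.
case: (boolP (e \in S)) => [/lS/eqP //|eS]; have eC : e \in ~: S by rewrite inE.
rewrite -(enum_rankK_in eC eC); apply: (indep (fun j => l (enum_val j))).
move: lf; rewrite mem_flow_space (bigID (mem (~: S))) /=.
rewrite [X in _ + X]big1 ?addr0; last first.
  by move=> e'; rewrite inE negbK => /lS/eqP ->; rewrite scale0r.
by rewrite big_enum_val => /eqP lf; rewrite -[RHS]lf; apply: eq_bigr => j _; rewrite Xi.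
Qed.

(** The crosscut sum runs over complements of forests; passing to complements costs the sign
    [(-1) ^+ #|edge G|]. *)
Lemma cographic_mobius :
    (forall e, ~~ (flow_space R G <= cographic_hyperplane R e)%VS) ->
  mobius (\bot%O : cographic_lattice R G) \top%O
  = (-1) ^+ #|edge G| * forest_sum R int [::] (map ends (enum (edge G))).
Proof.
move=> coloopless; rewrite [LHS](mobius_crosscut coloopless).
rewrite [arr_flat _ _ setT](val_cographic_top R G) -sum_acyclic_sets mulr_sumr.
rewrite (reindex_inj (inv_inj (@setCK _))) big_mkcond; apply: eq_bigr => A _.
rewrite arr_flat_eq0 setCK; case: ifP => _; last by rewrite !mulr0.
by rewrite mulr1 -(cardsC A) exprD mulrAC -expr2 sqrr_sign mul1r.
Qed.

End CographicMobius.

(** * The Möbius coinvariant of complete bipartite graphs *)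

(** Forest sums are integers, but the minors are evaluated by division, hence the passage through
    [rat]. *)
Lemma forest_sum_rat (F : fieldType) (d : nat) (B s : seq ('I_d * 'I_d)) :
  forest_sum F rat B s = (forest_sum F int B s)%:~R.
Proof.
elim: s B => [|e s IH] B /=; first by rewrite rmorph_nat.
by rewrite !IH rmorphB.
Qed.

Lemma herm_rat (a b : nat) (x y : int) :
  herm (x%:~R : rat) y%:~R a b = (herm x y a b)%:~R.
Proof.
rewrite /herm rmorph_sum; apply: eq_bigr => k _.
rewrite /herm_term [RHS]rmorphM; congr (_ * _); first by rewrite /= rmorph_nat.
by rewrite [RHS]rmorphM /= !rmorphXn.
Qed.

Lemma herm_ge0 (a b : nat) (x y : int) : 0 <= x -> 0 <= y -> 0 <= herm x y a b.
Proof.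
move=> x0 y0; apply: sumr_ge0 => k _.
by rewrite !mulr_ge0 ?exprn_ge0.
Qed.

(** Each minor depends on [M] only through its size, the diagonal entries being [- x] and [- y]. The
    signed sum is, up to [(-1) ^+ (a + b)], the opposite of the left side of [herm_defect]. *)
Lemma forest_sum_bip (F : fieldType) (a b : nat) :
  let x := b.+1%:Z in let y := a.+1%:Z in
  forest_sum F int [::] (map (@bip_edge a.+2 b.+2) (enum {: 'I_a.+2 * 'I_b.+2}))
  = - (-1) ^+ (a + b) * (x * y * herm x y a b).
Proof.
move=> x y; apply: (@intr_inj rat); rewrite -forest_sum_rat forest_sum_matching.
rewrite matching_sum_bip laplacian_bip.
have -> : 1 - a.+2%:R = - y%:~R :> rat by rewrite -natr1 opprD addrCA subrr addr0.
have -> : 1 - b.+2%:R = - x%:~R :> rat by rewrite -natr1 opprD addrCA subrr addr0.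
pose f k : rat := (- x%:~R) ^+ (a.+2 - k) * (- y%:~R) ^+ (b.+2 - k)
     - ((a.+2 - k) * (b.+2 - k))%:R *
       ((- x%:~R) ^+ (a.+2 - k).-1 * (- y%:~R) ^+ (b.+2 - k).-1).
rewrite (eq_bigr (fun M : {set 'I_a.+2 * 'I_b.+2} => f #|M|)); last first.
  move=> M mM; rewrite pminor_bip_block ?oppr_eq0 ?intr_eq0 //.
  have -> : #|[set i | lshift b.+2 i \notin covered M]| = (a.+2 - #|M|)%N.
    have := card_uncovered1 mM; rewrite /uncovered1.
    have -> : [set i | [forall p in M, p.1 != i]] =
              [set i | lshift b.+2 i \notin covered M].
      by apply/setP => i; rewrite in_set [RHS]in_set lshift_covered.
    lia.
  have -> : #|[set i | rshift a.+2 i \notin covered M]| = (b.+2 - #|M|)%N.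
    have := card_uncovered2 mM; rewrite /uncovered2.
    have -> : [set i | [forall p in M, p.2 != i]] =
              [set i | rshift a.+2 i \notin covered M].
      by apply/setP => i; rewrite in_set [RHS]in_set rshift_covered.
    lia.
  by [].
rewrite sum_matchings /f sum_signed_matchings -opprB.
rewrite [X in _ * - X](herm_defect rat a b).
rewrite -[b.+1%:R]/(x%:~R : rat) -[a.+1%:R]/(y%:~R : rat) herm_rat.
rewrite [RHS]rmorphM [X in _ = X * _]rmorphN [X in _ = - X * _]rmorphXn.
rewrite [X in _ = _ * X]rmorphM [X in _ = _ * (X * _)]rmorphM /=.
by rewrite addSn addnS !exprS rmorphN1; ring.
Qed.

Lemma not_connect_sink (T : finType) (r : rel T) (s t : T) :
  s != t -> (forall u, ~~ r u t) -> ~~ connect r s t.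
Proof.
move=> st nr; apply/connectP => -[p]; case/lastP: p => [_ /= ts|p z].
  by rewrite ts eqxx in st.
by rewrite rcons_path last_rcons => /andP[_ rz] tz; rewrite -tz (negPf (nr _)) in rz.
Qed.

Lemma not_connect_source (T : finType) (r : rel T) (s t : T) :
  s != t -> (forall u, ~~ r s u) -> ~~ connect r s t.
Proof.
move=> st nr; apply/connectP => -[[_ /= ts|z p /=]]; first by rewrite ts eqxx in st.
by rewrite (negPf (nr _)).
Qed.

(** For [m = 1] the target of [e] is a leaf, for [n = 1] its source is; no other edge reaches it. *)
Lemma star_isthmus (m n : nat) (e : edge (complete_bipartite m n)) :
  m = 1%N \/ n = 1%N -> isthmus e.
Proof.
case=> E; subst; rewrite /isthmus.
  apply: not_connect_sink; first by rewrite /= eq_lrshift.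
  move=> u; apply/existsP => -[f /andP[fe]]; rewrite /= eq_lrshift orbF eq_rshift.
  case/andP => _ /eqP eq2; case/eqP: fe; case: f e eq2 => [i j] [i' j'] /= ->.
  by rewrite !ord1.
apply: not_connect_source; first by rewrite /= eq_lrshift.
move=> u; apply/existsP => -[f /andP[fe]]; rewrite /= eq_rlshift andbF orbF eq_lshift.
case/andP => /eqP eq1 _; case/eqP: fe; case: f e eq1 => [i j] [i' j'] /= ->.
by rewrite !ord1.
Qed.

Lemma complete_bipartite_no_isthmus (a b : nat) (e : edge (complete_bipartite a.+2 b.+2)) :
  ~~ isthmus e.
Proof.
case: e => i j; rewrite negbK /=.
(* A second vertex on each side closes a 4-cycle through [e]. *)
pose i' := lift i ord0; pose j' := lift j ord0.
have ii : (i' == i) = false by rewrite eq_sym (negPf (neq_lift _ _)).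
have jj : (j' == j) = false by rewrite eq_sym (negPf (neq_lift _ _)).
apply: (@connect_trans _ _ (rshift a.+2 j'));
  last apply: (@connect_trans _ _ (lshift b.+2 i')).
- by apply/connect1/existsP; exists (i, j'); rewrite xpair_eqE jj andbF /= !eqxx.
- by apply/connect1/existsP; exists (i', j'); rewrite xpair_eqE jj andbF /= !eqxx orbT.
- by apply/connect1/existsP; exists (i', j); rewrite xpair_eqE ii /= !eqxx.
Qed.

(** A product of two vectors with zero sum is a flow; here it is the flow around a 4-cycle, with
    value 1 on [e]. *)
Lemma complete_bipartite_coloopless (R : realType) (a b : nat)
    (e : edge (complete_bipartite a.+2 b.+2)) :
  ~~ (flow_space R (complete_bipartite a.+2 b.+2) <= cographic_hyperplane R e)%VS.
Proof.
case: e => i j.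
pose al (k : 'I_a.+2) : R := (k == i)%:R - (k == lift i ord0)%:R.
pose be (k : 'I_b.+2) : R := (k == j)%:R - (k == lift j ord0)%:R.
have sum1 d (k : 'I_d) : \sum_h (h == k)%:R = 1 :> R.
  by rewrite (bigD1 k) //= eqxx big1 ?addr0 // => h /negPf ->.
have al0 : \sum_k al k = 0 by rewrite sumrB !sum1 subrr.
have be0 : \sum_k be k = 0 by rewrite sumrB !sum1 subrr.
pose l : {ffun edge (complete_bipartite a.+2 b.+2) -> R^o} := [ffun p => al p.1 * be p.2].
have lf : l \in flow_space R (complete_bipartite a.+2 b.+2).
  rewrite mem_flow_space; apply/eqP/rowP => h; rewrite summxE [RHS]mxE.
  transitivity (\sum_(p : 'I_a.+2 * 'I_b.+2)
      ((h == lshift b.+2 p.1)%:R * al p.1 * be p.2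
       - al p.1 * ((h == rshift a.+2 p.2)%:R * be p.2))).
    by apply: eq_bigr => p _; rewrite !mxE ffunE /=; ring.
  rewrite sumrB (sum_pairM (fun k => (h == lshift b.+2 k)%:R * al k) be) be0 mulr0.
  by rewrite (sum_pairM al (fun k => (h == rshift a.+2 k)%:R * be k)) al0 mul0r subr0.
apply/negP => /subvP/(_ l lf); rewrite mem_cographic_hyperplane lf /= ffunE /al /be /=.
by rewrite !eqxx !(negPf (neq_lift _ _)) !subr0 mulr1 oner_eq0.
Qed.

Theorem theorem5p14 (R : realType) (m n : nat) (hm : (1 <= m)%N) (hn : (1 <= n)%N) :
  mobius_coinvariant R (complete_bipartite m n) =
  (m%:Z - 1) * (n%:Z - 1) *
  (bip_hermite (m%:Z - 2) (n%:Z - 2)).[n%:Z - 1, m%:Z - 1].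
Proof.
rewrite /mobius_coinvariant.
case: m hm => [//|[|a]] _; first last.
case: n hn => [//|[|b]] _; first last.
- rewrite ifF; last by apply/existsP => -[e]; apply/negP/complete_bipartite_no_isthmus.
  rewrite cographic_mobius; last exact: complete_bipartite_coloopless.
  rewrite [forest_sum _ _ _ _](forest_sum_bip R a b).
  have -> : a.+2%:Z - 1 = a.+1%:Z by lia.
  have -> : b.+2%:Z - 1 = b.+1%:Z by lia.
  rewrite [X in bip_hermite X _](_ : _ = a%:Z); last by lia.
  rewrite [X in bip_hermite _ X](_ : _ = b%:Z); last by lia.
  (* The absolute value removes all signs, as the Hermite value at nonnegative arguments is
     nonnegative. *)
  rewrite bip_hermite_herm 2!normrM normrN !normrX normrN1 !expr1n !mul1r.
  by rewrite ger0_norm ?mulr_ge0 ?herm_ge0 // [X in X * _]mulrC.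
(* A star has an isthmus, so the left side is 0 by convention, and a factor on the right
   vanishes. *)
- rewrite ifT; first by rewrite subrr mulr0 mul0r.
  by apply/existsP; exists (ord0, ord0); apply: star_isthmus; right.
rewrite ifT; first by rewrite subrr !mul0r.
by case: n hn => // n _; apply/existsP; exists (ord0, ord0); apply: star_isthmus; left.
Qed.
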